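(* Let $\mathbf z$ be a finite tuple of variables and let $\varphi\in\mathcal F_{\mathbf z}$; assume without loss of generality that $\varphi$ is in real normal form (i.e. an arbitrary formula in $\mathcal F_{\mathbf z}$ is first replaced by an equivalent one in real normal form). Apply the following three steps to compute from $\varphi$ a quantifier-free formula $\varphi'\in\mathcal Q_{\mathbf z}$. 1. (Purification.) Replace all subterms $\Re(z_i)$ and $\Im(z_i)$ in $\varphi$ with auxiliary variables $z_i^{\Re}$ and $z_i^{\Im}$, respectively. Furthermore, replace all quantifiers $\exists z_i$ and $\forall z_i$ in $\varphi$ with $\exists z_i^{\Re}\exists z_i^{\Im}$ and $\forall z_i^{\Re}\forall z_i^{\Im}$, respectively. This yields a first-order formula $\psi$ in the language of ordered rings. 2. (Real quantifier elimination.) Apply any real quantifier elimination procedure to obtain a quantifier-free formula $\psi'$ in the language of ordered rings such that $\mathbb R\models\psi\longleftrightarrow\psi'$. 3. (Substitution.) Remove the auxiliary variables via substitution of the original terms, i.e. let $\varphi'=\psi'[z_i^{\Re}\gets\Re(z_i),\ z_i^{\Im}\gets\Im(z_i)]\in\mathcal Q_{\mathbf z}$. Then $\mathbb C\models\varphi\longleftrightarrow\varphi'$. In other words, the three steps establish a quantifier elimination procedure for the complex numbers in the language $\mathcal L$.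
   Context: Language and terms. The language $\mathcal L$ has the function symbols: a constant $q$ for every rational $q\ge 0$, a constant $\mathrm i$, binary $+$ and $\cdot$, unary $-$, and unary $\Re$, $\Im$, $\overline{\,\cdot\,}$; and the binary relation symbols $<,\le,\ne$. Equality $=$ is a logical symbol. $(\mathcal V,\prec)$ is a fixed countably infinite strictly ordered set of variables. $\mathcal T$ is the set of all terms, and for $\mathbf z=(z_1,\dots,z_n)$ with $z_1\prec\dots\prec z_n$ in $\mathcal V$, $n\in\mathbb N$, $\mathcal T_{\mathbf z}$ is the set of terms with variables among $\mathbf z$. Each $t\in\mathcal T_{\mathbf z}$ induces a function $t(\mathbf z)^*:\mathbb C^n\to\mathbb C$ by interpreting the symbols in the usual way ($\mathrm i$ as the imaginary unit, $\Re,\Im$ as real and imaginary part, $\overline{\,\cdot\,}$ as complex conjugation). A term $t\in\mathcal T_{\mathbf z}$ is a real term if $t(\mathbf z)^*$ takes only real values on $\mathbb C^n$. Formulas. Atoms are $t_1=t_2$, $t_1\ne t_2$ with $t_1,t_2\in\mathcal T$ arbitrary, and $r_1\le r_2$, $r_1<r_2$ with $r_1,r_2$ real terms. Quantifier-free formulas are built from atoms, $\top$, $\bot$ using $\lnot$, $\land$, $\lor$ (arbitrary arity), $\longrightarrow$, $\longleftrightarrow$. Prenex first-order formulas are obtained from quantifier-free formulas by prefixing quantifiers $\exists z,\forall z$ with $z\in\mathcal V$; $\mathcal F$ is the set of them. A variable that appears in an atom of $\varphi$ is bound if it also appears in a quantifier of $\varphi$, and free otherwise. $\mathcal Q_{\mathbf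 z}$ is the set of quantifier-free formulas with variables among $\mathbf z$, and $\mathcal F_{\mathbf z}\subseteq\mathcal F$ is the set of formulas all of whose free variables are among $\mathbf z$. Formulas are interpreted in the usual way with all variables and quantifiers ranging over $\mathbb C$, where $<,\le$ are the usual order on the real values of real terms. $\mathbb C\models\chi$ means that $\chi$ is true for all complex values of its free variables. Two formulas $\varphi_1,\varphi_2$ are equivalent if $\mathbb C\models\varphi_1\longleftrightarrow\varphi_2$. Real normal form. A formula $\varphi\in\mathcal F_{\mathbf z}$ is in real normal form if every atom of $\varphi$ has right-hand side $0$ and its left-hand side is a polynomial with rational coefficients in the expressions $\Re(z_i),\Im(z_i)$, where the $z_i$ range over the variables (free and bound) of $\varphi$. Every formula in $\mathcal F_{\mathbf z}$ is equivalent to one in real normal form. Real quantifier elimination. The language of ordered rings here has rational constants, $+,-,\cdot$ and the relations $<,\le,\ne$, interpreted over $\mathbb R$. A real quantifier elimination procedure is an algorithm which, for each first-order formula $\psi$ in this language, computes a quantifier-free formula $\psi'$ whose variables are among the free variables of $\psi$ such that $\mathbb R\models\psi\longleftrightarrow\psi'$. The auxiliary variables $z_i^{\Re},z_i^{\Im}$ are pairwise distinct variables, two for each variable $z_i$ (free or bound) of $\varphi$. A quantifier elimination procedure for the complex numbers in $\mathcal L$ is an algorithm which, for each formula in $\mathcal F_{\mathbf z}$, computes an equivalent formula in $\mathcal Q_{\mathbf z}$. *)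

(* Defs.v *)
From Stdlib Require List.
From mathcomp Require Import all_boot all_order all_algebra.
From mathcomp Require Import reals.
From mathcomp Require Import complex.

Set Implicit Arguments.
Unset Strict Implicit.
Unset Printing Implicit Defensive.

Import Order.TTheory GRing.Theory Num.Theory.

Local Open Scope ring_scope.
Local Open Scope complex_scope.

Inductive cmp := CEq | CNe | CLe | CLt.

(* First-order formulas with variables in V over terms in T, with nested
   quantifiers allowed everywhere; the prenex ones are singled out below. *)
Inductive fo_form (V T : Type) : Type :=
| Atom of cmp & T & T
| Top
| Bot
| Not of fo_form V T
| And of seq (fo_form V T)
| Or of seq (fo_form V T)
| Imp of fo_form V T & fo_form V T
| Iff of fo_form V T & fo_form V T
| Ex of V & fo_form V T
| All of V & fo_form V T.

Arguments Top {V T}.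
Arguments Bot {V T}.

Section Syntax.
Variables (V : eqType) (T : Type).

Fixpoint qfree (f : fo_form V T) : bool :=
  match f with
  | Atom _ _ _ | Top | Bot => true
  | Not g => qfree g
  | And fs | Or fs => all qfree fs
  | Imp g h | Iff g h => qfree g && qfree h
  | Ex _ _ | All _ _ => false
  end.

Fixpoint prenex (f : fo_form V T) : bool :=
  match f with
  | Ex _ g | All _ g => prenex g
  | _ => qfree f
  end.

Fixpoint atoms (f : fo_form V T) : seq (cmp * T * T) :=
  match f with
  | Atom c t1 t2 => [:: (c, t1, t2)]
  | Top | Bot => [::]
  | Not g => atoms g
  | And fs | Or fs => flatten (map atoms fs)
  | Imp g h | Iff g h => atoms g ++ atoms h
  | Ex _ g | All _ g => atoms g
  end.

Fixpoint quant_vars (f : fo_form V T) : seq V :=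
  match f with
  | Atom _ _ _ | Top | Bot => [::]
  | Not g => quant_vars g
  | And fs | Or fs => flatten (map quant_vars fs)
  | Imp g h | Iff g h => quant_vars g ++ quant_vars h
  | Ex x g | All x g => x :: quant_vars g
  end.

Variable tvars : T -> seq V.

Definition atom_vars (f : fo_form V T) : seq V :=
  flatten [seq tvars a.1.2 ++ tvars a.2 | a <- atoms f].

Definition all_vars (f : fo_form V T) : seq V := atom_vars f ++ quant_vars f.

(* Global notion of free variable, only meaningful for prenex formulas, where
   every atom lies in the scope of every quantifier. *)
Definition prenex_fv (f : fo_form V T) : seq V :=
  [seq x <- atom_vars f | x \notin quant_vars f].

(* Scoped notion of free variable, for arbitrary formulas. *)
Fixpoint fv (f : fo_form V T) : seq V :=
  match f with
  | Atom _ t1 t2 => tvars t1 ++ tvars t2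
  | Top | Bot => [::]
  | Not g => fv g
  | And fs | Or fs => flatten (map fv fs)
  | Imp g h | Iff g h => fv g ++ fv h
  | Ex x g | All x g => [seq y <- fv g | y != x]
  end.

End Syntax.

Section Semantics.
Variables (V : eqType) (T : Type) (D : numDomainType).
Variable eval : (V -> D) -> T -> D.

Definition holds_cmp (c : cmp) (a b : D) : Prop :=
  match c with
  | CEq => a = b
  | CNe => a <> b
  | CLe => a <= b
  | CLt => a < b
  end.

Fixpoint holds (e : V -> D) (f : fo_form V T) : Prop :=
  match f with
  | Atom c t1 t2 => holds_cmp c (eval e t1) (eval e t2)
  | Top => True
  | Bot => False
  | Not g => ~ holds e g
  | And fs => foldr (fun g P => holds e g /\ P) True fs
  | Or fs => foldr (fun g P => holds e g \/ P) False fs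
  | Imp g h => holds e g -> holds e h
  | Iff g h => holds e g <-> holds e h
  | Ex x g => exists a : D, holds [eta e with x |-> a] g
  | All x g => forall a : D, holds [eta e with x |-> a] g
  end.

Definition models (f : fo_form V T) : Prop := forall e : V -> D, holds e f.

End Semantics.

Inductive term (V : Type) : Type :=
| TVar of V
| TRat of {q : rat | 0 <= q}
| TI
| TAdd of term V & term V
| TMul of term V & term V
| TOpp of term V
| TRe of term V
| TIm of term V
| TConj of term V.

Arguments TRat {V}.
Arguments TI {V}.

Inductive rterm (V : Type) : Type :=
| RVar of V
| RRat of rat
| RAdd of rterm V & rterm V
| RMul of rterm V & rterm V
| ROpp of rterm V.

Arguments RRat {V}.

Notation cform V := (fo_form V (term V)).
Notation rform V := (fo_form V (rterm V)).

Section Interpretation.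
Variables (V : eqType) (R : realType).

Fixpoint term_vars (t : term V) : seq V :=
  match t with
  | TVar z => [:: z]
  | TRat _ | TI => [::]
  | TAdd a b | TMul a b => term_vars a ++ term_vars b
  | TOpp a | TRe a | TIm a | TConj a => term_vars a
  end.

Fixpoint teval (e : V -> R[i]) (t : term V) : R[i] :=
  match t with
  | TVar z => e z
  | TRat q => ratr (sval q)
  | TI => 'i
  | TAdd a b => teval e a + teval e b
  | TMul a b => teval e a * teval e b
  | TOpp a => - teval e a
  | TRe a => (complex.Re (teval e a))%:C
  | TIm a => (complex.Im (teval e a))%:C
  | TConj a => (teval e a)^*
  end.

Definition real_term (t : term V) : Prop :=
  forall e : V -> R[i], teval e t \is Num.real.

Definition wf_atom (a : cmp * term V * term V) : Prop :=
  let: (c, t1, t2) := a in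
  match c with
  | CEq | CNe => True
  | CLe | CLt => real_term t1 /\ real_term t2
  end.

(* The order of R[i] is partial, but it is the usual order on real values,
   to which wf_atom restricts the atoms using it. *)
Definition wf_form (f : cform V) : Prop := List.Forall wf_atom (atoms f).

Definition in_Q (z : seq V) (f : cform V) : Prop :=
  [/\ qfree f, wf_form f & {subset atom_vars term_vars f <= z}].

Definition in_F (z : seq V) (f : cform V) : Prop :=
  [/\ prenex f, wf_form f & {subset prenex_fv term_vars f <= z}].

Definition C_models (f : cform V) : Prop := models teval f.

Fixpoint rterm_vars (t : rterm V) : seq V :=
  match t with
  | RVar w => [:: w]
  | RRat _ => [::]
  | RAdd a b | RMul a b => rterm_vars a ++ rterm_vars b
  | ROpp a => rterm_vars a
  end.

Fixpoint reval (e : V -> R) (t : rterm V) : R :=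
  match t with
  | RVar w => e w
  | RRat q => ratr q
  | RAdd a b => reval e a + reval e b
  | RMul a b => reval e a * reval e b
  | ROpp a => - reval e a
  end.

Definition R_models (f : rform V) : Prop := models reval f.

Definition real_qe (rqe : rform V -> rform V) : Prop :=
  forall psi : rform V,
    [/\ qfree (rqe psi),
        {subset atom_vars rterm_vars (rqe psi) <= fv rterm_vars psi}
      & R_models (Iff psi (rqe psi))].

Definition complex_qe (z : seq V) (p : cform V -> cform V) : Prop :=
  forall phi : cform V, in_F z phi ->
    in_Q z (p phi) /\ C_models (Iff phi (p phi)).

End Interpretation.

Section NormalForm.
Variable V : eqType.

Definition nnrat (q : rat) : {q : rat | 0 <= q} := exist _ `|q| (normr_ge0 q).

Definition T0 : term V := TRat (nnrat 0).
Definition T1 : term V := TRat (nnrat 1).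

(* Polynomials need not be expanded; negative rational coefficients are written
   with unary minus, as the constants are nonnegative. *)
Fixpoint re_im_poly (t : term V) : bool :=
  match t with
  | TRe (TVar _) | TIm (TVar _) | TRat _ => true
  | TAdd a b | TMul a b => re_im_poly a && re_im_poly b
  | TOpp a => re_im_poly a
  | _ => false
  end.

Definition is_T0 (t : term V) : bool :=
  if t is TRat q then sval q == 0 else false.

Definition real_normal_form (f : cform V) : bool :=
  all (fun a => re_im_poly a.1.2 && is_T0 a.2) (atoms f).

Definition normalization (R : realType) (z : seq V) (nf : cform V -> cform V) :
    Prop :=
  forall phi : cform V, in_F R z phi ->
    [/\ in_F R z (nf phi), real_normal_form (nf phi)
      & C_models R (Iff phi (nf phi))].

(* re_im t is a pair of terms for the real and the imaginary part of t. *)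
Fixpoint re_im (t : term V) : term V * term V :=
  match t with
  | TVar z => (TRe (TVar z), TIm (TVar z))
  | TRat q => (TRat q, T0)
  | TI => (T0, T1)
  | TAdd a b =>
      let: (ra, ia) := re_im a in
      let: (rb, ib) := re_im b in
      (TAdd ra rb, TAdd ia ib)
  | TMul a b =>
      let: (ra, ia) := re_im a in
      let: (rb, ib) := re_im b in
      (TAdd (TMul ra rb) (TOpp (TMul ia ib)), TAdd (TMul ra ib) (TMul ia rb))
  | TOpp a => let: (ra, ia) := re_im a in (TOpp ra, TOpp ia)
  | TRe a => ((re_im a).1, T0)
  | TIm a => ((re_im a).2, T0)
  | TConj a => let: (ra, ia) := re_im a in (ra, TOpp ia)
  end.

Definition normalize_atom (c : cmp) (t1 t2 : term V) : cform V :=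
  let: (r, i) := re_im (TAdd t1 (TOpp t2)) in
  match c with
  | CEq => And [:: Atom V CEq r T0; Atom V CEq i T0]
  | CNe => Or [:: Atom V CNe r T0; Atom V CNe i T0]
  | CLe | CLt => Atom V c r T0
  end.

Fixpoint normalize (f : cform V) : cform V :=
  match f with
  | Atom c t1 t2 => normalize_atom c t1 t2
  | Top => Top
  | Bot => Bot
  | Not g => Not (normalize g)
  | And fs => And (map normalize fs)
  | Or fs => Or (map normalize fs)
  | Imp g h => Imp (normalize g) (normalize h)
  | Iff g h => Iff (normalize g) (normalize h)
  | Ex x g => Ex x (normalize g)
  | All x g => All x (normalize g)
  end.

End NormalForm.

Section ThreeSteps.
Variable V : eqType.

(* re x and im x are the auxiliary variables of x; being variables of a formula
   in another language, they may coincide with variables of the original one. *)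
Definition aux_vars (f : cform V) (re im : V -> V) : Prop :=
  let vs := all_vars (@term_vars V) f in
  [/\ {in vs &, injective re}, {in vs &, injective im}
    & {in vs &, forall x y, re x != im y}].

Section Purification.
Variables re im : V -> V.

(* The default case never arises on formulas in real normal form. *)
Fixpoint purify_term (t : term V) : rterm V :=
  match t with
  | TRe (TVar z) => RVar (re z)
  | TIm (TVar z) => RVar (im z)
  | TRat q => RRat (sval q)
  | TAdd a b => RAdd (purify_term a) (purify_term b)
  | TMul a b => RMul (purify_term a) (purify_term b)
  | TOpp a => ROpp (purify_term a)
  | _ => RRat 0
  end.

Fixpoint purify (f : cform V) : rform V :=
  match f with
  | Atom c t1 t2 => Atom V c (purify_term t1) (purify_term t2)
  | Top => Top
  | Bot => Bot
  | Not g => Not (purify g)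
  | And fs => And (map purify fs)
  | Or fs => Or (map purify fs)
  | Imp g h => Imp (purify g) (purify h)
  | Iff g h => Iff (purify g) (purify h)
  | Ex z g => Ex (re z) (Ex (im z) (purify g))
  | All z g => All (re z) (All (im z) (purify g))
  end.

(* The substitution [re x <- Re x, im x <- Im x] for x in vs. *)
Definition aux_subst (vs : seq V) (w : V) : term V :=
  if [seq x <- vs | re x == w] is x :: _ then TRe (TVar x)
  else if [seq x <- vs | im x == w] is x :: _ then TIm (TVar x)
  else TVar w.

End Purification.

Fixpoint subst_term (s : V -> term V) (t : rterm V) : term V :=
  match t with
  | RVar w => s w
  | RRat q => if 0 <= q then TRat (nnrat q) else TOpp (TRat (nnrat q))
  | RAdd a b => TAdd (subst_term s a) (subst_term s b)
  | RMul a b => TMul (subst_term s a) (subst_term s b)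
  | ROpp a => TOpp (subst_term s a)
  end.

(* Only used on quantifier-free formulas: no care is taken of capture. *)
Fixpoint subst (s : V -> term V) (f : rform V) : cform V :=
  match f with
  | Atom c t1 t2 => Atom V c (subst_term s t1) (subst_term s t2)
  | Top => Top
  | Bot => Bot
  | Not g => Not (subst s g)
  | And fs => And (map (subst s) fs)
  | Or fs => Or (map (subst s) fs)
  | Imp g h => Imp (subst s g) (subst s h)
  | Iff g h => Iff (subst s g) (subst s h)
  | Ex x g => Ex x (subst s g)
  | All x g => All x (subst s g)
  end.

Definition three_steps (rqe : rform V -> rform V) (re im : V -> V)
    (phi : cform V) : cform V :=
  let psi := purify re im phi in
  let psi' := rqe psi in
  subst (aux_subst re im (all_vars (@term_vars V) phi)) psi'.

End ThreeSteps.

(* Main.v *)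
(** A real normal form sees a complex number only through its real and
    imaginary parts.  Hence [phi] holds at [e] iff its purification holds at any
    real valuation assigning [Re (e x)] and [Im (e x)] to the auxiliary variables
    of [x]: a quantifier over [C = R * R] is a pair of quantifiers over [R].
    The substitution of step 3 turns [e] into such a valuation.  The free
    variables left by the elimination are auxiliary variables of free variables
    of [phi], so the substitution produces only real terms over [z]. *)

Require Import Defs.
From mathcomp Require Import all_boot all_order all_algebra.
From mathcomp Require Import reals.
From Stdlib Require List.
From mathcomp Require Import complex.

Set Implicit Arguments.
Unset Strict Implicit.
Unset Printing Implicit Defensive.

Import Order.TTheory GRing.Theory Num.Theory.

Local Open Scope ring_scope.
Local Open Scope complex_scope.

(** * Predicates and equivalences along lists *)

Section ForallSeq.
Variables (A B : Type).
Implicit Types (P : A -> Prop) (s : seq A).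

(** Fills a side condition of [fo_form_Forall_ind] when there is no invariant to carry on the atoms
    or on the quantified variables. *)
Lemma Forall_True s : List.Forall (fun=> True) s.
Proof. by elim: s; constructor. Qed.

Lemma Forall_cat P s1 s2 :
  List.Forall P (s1 ++ s2) <-> List.Forall P s1 /\ List.Forall P s2.
Proof. exact: List.Forall_app. Qed.

Lemma Forall_flatten_map P (h : B -> seq A) (s : seq B) :
  List.Forall P (flatten (map h s)) <->
  List.Forall (fun x => List.Forall P (h x)) s.
Proof.
elim: s => [|x s IHs] /=; first by split=> _; constructor.
by rewrite Forall_cat List.Forall_cons_iff IHs.
Qed.

Lemma all_Forall (p : pred A) s : all p s -> List.Forall p s.
Proof.
by elim: s => //= x s IHs /andP[px ps]; constructor; [|apply: IHs].
Qed.

Lemma Forall_all (p : pred A) s : List.Forall p s -> all p s.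
Proof. by elim=> //= x {}s -> _ ->. Qed.

Lemma Forall_all_map (p : pred A) (q : pred B) (h : A -> B) s :
  List.Forall (fun x => p x -> q (h x)) s -> all p s -> all q (map h s).
Proof. by elim=> //= x {}s pq _ IHs /andP[/pq-> /IHs]. Qed.

Lemma foldr_and_iff (P : A -> Prop) (Q : B -> Prop) (h : A -> B) s :
  List.Forall (fun x => P x <-> Q (h x)) s ->
  foldr (fun x X => P x /\ X) True s <->
  foldr (fun x X => Q x /\ X) True (map h s).
Proof. by elim=> //= x {}s -> _ ->. Qed.

Lemma foldr_or_iff (P : A -> Prop) (Q : B -> Prop) (h : A -> B) s :
  List.Forall (fun x => P x <-> Q (h x)) s ->
  foldr (fun x X => P x \/ X) False s <->
  foldr (fun x X => Q x \/ X) False (map h s).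
Proof. by elim=> //= x {}s -> _ ->. Qed.

End ForallSeq.

Lemma Forall_subset_flatten (A : Type) (V : eqType) (h : A -> seq V)
    (s : seq A) (z : seq V) :
  List.Forall (fun a => {subset h a <= z}) s <-> {subset flatten (map h s) <= z}.
Proof.
elim: s => [|x s IHs] /=; first by split=> // _; constructor.
rewrite List.Forall_cons_iff IHs; split=> [[hx hs] y|hs].
  by rewrite mem_cat => /orP[/hx|/hs].
by split=> y y_in; apply: hs; rewrite mem_cat y_in ?orbT.
Qed.

(** * Induction on formulas, and their variables *)

Section Formulas.
Variables (V : eqType) (T : Type).
Implicit Types (f : fo_form V T) (z : seq V).

(** Induction that reaches inside the lists of [And] and [Or] and carries two invariants: [Pa] on
    all atoms and [Pv] on all quantified variables. Side conditions on a whole formula thus arrive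
    at its atoms and quantifiers without being split again at each connective. *)
Lemma fo_form_Forall_ind (Pa : cmp * T * T -> Prop) (Pv : V -> Prop)
    (P : fo_form V T -> Prop) :
  (forall c t1 t2, Pa (c, t1, t2) -> P (Atom V c t1 t2)) ->
  P Top -> P Bot ->
  (forall f, P f -> P (Not f)) ->
  (forall fs, List.Forall P fs -> P (And fs)) ->
  (forall fs, List.Forall P fs -> P (Or fs)) ->
  (forall f g, P f -> P g -> P (Imp f g)) ->
  (forall f g, P f -> P g -> P (Iff f g)) ->
  (forall x f, Pv x -> P f -> P (Ex x f)) ->
  (forall x f, Pv x -> P f -> P (All x f)) ->
  forall f, List.Forall Pa (atoms f) -> List.Forall Pv (quant_vars f) -> P f.
Proof.
move=> PAtom PTop PBot PNot PAnd POr PImp PIff PEx PAll.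
fix IH 1 => -[c t1 t2|||f|fs|fs|f g|f g|x f|x f] /=.
- by move=> Pat _; apply: PAtom; apply: (List.Forall_inv Pat).
- by [].
- by [].
- by move=> Pat Pq; apply/PNot/IH.
- rewrite !Forall_flatten_map => Pat Pq; apply: PAnd.
  (* The inner induction on the list keeps every call of [IH] on a structural subterm, as the guard
     condition demands. *)
  elim: fs Pat Pq => [|f fs IHfs]; first by constructor.
  rewrite !List.Forall_cons_iff => -[Pf Pfs] [qf qfs].
  by split; [apply: IH|apply: IHfs].
- rewrite !Forall_flatten_map => Pat Pq; apply: POr.
  elim: fs Pat Pq => [|f fs IHfs]; first by constructor.
  rewrite !List.Forall_cons_iff => -[Pf Pfs] [qf qfs].
  by split; [apply: IH|apply: IHfs].
- by rewrite !Forall_cat => -[Pf Pg] [qf qg]; apply: PImp; apply: IH.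
- by rewrite !Forall_cat => -[Pf Pg] [qf qg]; apply: PIff; apply: IH.
- by rewrite List.Forall_cons_iff => Pf [qx qf]; apply: PEx => //; apply: IH.
- by rewrite List.Forall_cons_iff => Pf [qx qf]; apply: PAll => //; apply: IH.
Qed.

Lemma fo_form_nested_ind (P : fo_form V T -> Prop) :
  (forall c t1 t2, P (Atom V c t1 t2)) ->
  P Top -> P Bot ->
  (forall f, P f -> P (Not f)) ->
  (forall fs, List.Forall P fs -> P (And fs)) ->
  (forall fs, List.Forall P fs -> P (Or fs)) ->
  (forall f g, P f -> P g -> P (Imp f g)) ->
  (forall f g, P f -> P g -> P (Iff f g)) ->
  (forall x f, P f -> P (Ex x f)) ->
  (forall x f, P f -> P (All x f)) ->
  forall f, P f.
Proof.
move=> PAtom PTop PBot PNot PAnd POr PImp PIff PEx PAll f.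
by apply: (fo_form_Forall_ind (Pa := fun=> True) (Pv := fun=> True)) => //;
   [move=> x g _; exact: PEx | move=> x g _; exact: PAll
   | exact: Forall_True..].
Qed.

Lemma qfree_quant_vars f : qfree f -> quant_vars f = [::].
Proof.
elim/fo_form_nested_ind: f => //= [fs|fs|f g IHf IHg|f g IHf IHg];
  do ?[by move=> /andP[/IHf-> /IHg->]].
all: by elim=> //= f {}fs IHf _ IHfs /andP[/IHf-> /IHfs].
Qed.

(** Turns a global inclusion of variables into the atomwise form that serves as an invariant
    [Pa]. *)
Lemma subset_atom_vars (tv : T -> seq V) f z :
  {subset atom_vars tv f <= z} <->
  List.Forall (fun a => {subset tv a.1.2 ++ tv a.2 <= z}) (atoms f).
Proof. by rewrite Forall_subset_flatten. Qed.

(** Free variables come from atoms, and passing a quantifier only removes some of them. *)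
Lemma fv_subset (tv : T -> seq V) f z :
  List.Forall (fun a => {subset tv a.1.2 ++ tv a.2 <= z}) (atoms f) ->
  {subset fv tv f <= z}.
Proof.
move=> fz; pattern f; apply: fo_form_Forall_ind fz (Forall_True (quant_vars f)) => //=.
- by move=> fs /Forall_subset_flatten.
- by move=> fs /Forall_subset_flatten.
- by move=> g h gz hz x; rewrite mem_cat => /orP[/gz|/hz].
- by move=> g h gz hz x; rewrite mem_cat => /orP[/gz|/hz].
- by move=> x g _ gz y; rewrite mem_filter => /andP[_ /gz].
- by move=> x g _ gz y; rewrite mem_filter => /andP[_ /gz].
Qed.

End Formulas.

(** * Real and imaginary parts of terms *)

Section ReIm.
Variables (V : eqType) (R : realType).
Implicit Types (e : V -> R[i]) (t : term V).

(** Complex numbers are comparable only if their imaginary parts agree, so being comparable with 0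
    forces a zero imaginary part; the converse is totality of the order on [R]. *)
Lemma realCE (x : R[i]) : (x \is Num.real) = (complex.Im x == 0).
Proof.
rewrite realE !lecE /= [0 == _]eq_sym.
by case: eqP => //= _; exact: le_total.
Qed.

Lemma holds_cmp_real c (a b : R) : holds_cmp c a%:C b%:C <-> holds_cmp c a b.
Proof.
case: c => /=; rewrite ?lecR ?ltcR //.
- by split=> [/complexI|->].
- by split=> ab /=; [move=> eq_ab; apply: ab; rewrite eq_ab|move=> /complexI].
Qed.

Lemma ratrC (q : rat) : ratr q = (ratr q)%:C :> R[i].
Proof. by rewrite fmorph_rat. Qed.

Lemma teval_T0 e : teval e (T0 V) = 0.
Proof. by rewrite /= normr0 rmorph0. Qed.

Lemma re_im_poly_re_im t : re_im_poly (re_im t).1 && re_im_poly (re_im t).2.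
Proof.
elim: t => [x|q||a IHa b IHb|a IHa b IHb|a IHa|a IHa|a IHa|a IHa] //=.
- case: (re_im a) (re_im b) IHa IHb => [ra ia] [rb ib] /=.
  by move=> /andP[-> ->] /andP[-> ->].
- case: (re_im a) (re_im b) IHa IHb => [ra ia] [rb ib] /=.
  by move=> /andP[-> ->] /andP[-> ->].
- by case: (re_im a) IHa.
- by case/andP: IHa => ->.
- by case/andP: IHa => _ ->.
- by case: (re_im a) IHa.
Qed.

(** Both components are proved together because products and the terms [TIm] mix them. The pair of
    equations also serves as a multirule for [rewrite]. *)
Lemma teval_re_im e t :
  (teval e (re_im t).1 = (complex.Re (teval e t))%:C) *
  (teval e (re_im t).2 = (complex.Im (teval e t))%:C).
Proof.
elim: t => [x|q||a IHa b IHb|a IHa b IHb|a IHa|a IHa|a IHa|a IHa] /=.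
- by [].
- by rewrite ratrC normr0 !rmorph0.
- by rewrite normr0 normr1 rmorph0 rmorph1.
- case: (re_im a) (re_im b) IHa IHb => [ra ia] [rb ib] /= [-> ->] [-> ->].
  by rewrite -!rmorphD; case: (teval e a) (teval e b) => [? ?] [? ?].
- case: (re_im a) (re_im b) IHa IHb => [ra ia] [rb ib] /= [-> ->] [-> ->].
  rewrite -!rmorphM -rmorphB -rmorphD.
  by case: (teval e a) (teval e b) => [? ?] [? ?].
- case: (re_im a) IHa => [ra ia] /= [-> ->].
  by rewrite -!rmorphN; case: (teval e a).
- by rewrite IHa normr0 rmorph0.
- by rewrite IHa normr0 rmorph0.
- case: (re_im a) IHa => [ra ia] /= [-> ->].
  by rewrite -!rmorphN; case: (teval e a).
Qed.

Lemma re_im_vars t :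
  {subset term_vars (re_im t).1 ++ term_vars (re_im t).2 <= term_vars t}.
Proof.
elim: t => [x|q||a IHa b IHb|a IHa b IHb|a IHa|a IHa|a IHa|a IHa] //=.
- by move=> y; rewrite !inE orbb.
- case: (re_im a) (re_im b) IHa IHb => [ra ia] [rb ib] /= IHa IHb x.
  rewrite !mem_cat => x_in; move: (IHa x) (IHb x); rewrite !mem_cat => xa xb.
  have /orP[/xa->|/xb->] : (x \in term_vars ra) || (x \in term_vars ia)
      || ((x \in term_vars rb) || (x \in term_vars ib)).
  - by move: x_in; do 4!case: (x \in _).
  - by [].
  - by rewrite orbT.
- case: (re_im a) (re_im b) IHa IHb => [ra ia] [rb ib] /= IHa IHb x.
  rewrite !mem_cat => x_in; move: (IHa x) (IHb x); rewrite !mem_cat => xa xb.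
  have /orP[/xa->|/xb->] : (x \in term_vars ra) || (x \in term_vars ia)
      || ((x \in term_vars rb) || (x \in term_vars ib)).
  - by move: x_in; do 4!case: (x \in _).
  - by [].
  - by rewrite orbT.
- by case: (re_im a) IHa.
- by move=> x; rewrite cats0 => xa; apply: IHa; rewrite mem_cat xa.
- by move=> x; rewrite cats0 => xa; apply: IHa; rewrite mem_cat xa orbT.
- by case: (re_im a) IHa.
Qed.

End ReIm.

(** * Every formula has an equivalent real normal form *)

Section Normalization.
Variables (V : eqType) (R : realType).
Implicit Types (e : V -> R[i]) (t : term V) (f : cform V).

Lemma qfree_normalize f : qfree f -> qfree (normalize f).
Proof.
elim/fo_form_nested_ind: f
  => //= [c t1 t2|fs IHfs|fs IHfs|f g IHf IHg|f g IHf IHg].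
- by rewrite /normalize_atom; case: (re_im _) => r i; case: c.
- exact: Forall_all_map.
- exact: Forall_all_map.
- by move=> /andP[/IHf-> /IHg->].
- by move=> /andP[/IHf-> /IHg->].
Qed.

Lemma prenex_normalize f : prenex f -> prenex (normalize f).
Proof.
elim/fo_form_nested_ind: f => //= [c t1 t2 _|f _|fs _|fs _|f g _ _|f g _ _].
- by rewrite /normalize_atom; case: (re_im _) => r i; case: c.
- exact: (@qfree_normalize (Not f)).
- exact: (@qfree_normalize (And fs)).
- exact: (@qfree_normalize (Or fs)).
- exact: (@qfree_normalize (Imp f g)).
- exact: (@qfree_normalize (Iff f g)).
Qed.

Lemma quant_vars_normalize f : quant_vars (normalize f) = quant_vars f.
Proof.
elim/fo_form_nested_ind: f
  => //= [c t1 t2|fs|fs|f g -> ->|f g -> ->|x f ->|x f ->] //.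
- by rewrite /normalize_atom; case: (re_im _) => r i; case: c.
- by elim=> //= f {}fs -> _ ->.
- by elim=> //= f {}fs -> _ ->.
Qed.

(** Normalization acts on each atom separately, so an atomwise property of the result need only be
    checked on [normalize_atom]. *)
Lemma Forall_atoms_normalize (P Q : cmp * term V * term V -> Prop) f :
  (forall c t1 t2, P (c, t1, t2) ->
     List.Forall Q (atoms (normalize_atom c t1 t2))) ->
  List.Forall P (atoms f) -> List.Forall Q (atoms (normalize f)).
Proof.
move=> PQ fP.
pattern f; apply: fo_form_Forall_ind fP (Forall_True (quant_vars f))
  => //= [fs|fs|g h|g h].
- by move=> IHfs; rewrite -map_comp; apply/Forall_flatten_map.
- by move=> IHfs; rewrite -map_comp; apply/Forall_flatten_map.
- by rewrite Forall_cat.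
- by rewrite Forall_cat.
Qed.

(** A complex equation is a pair of real ones. For the order relations, well-formedness makes both
    imaginary parts vanish, so the sign of the real part of the difference decides. *)
Lemma holds_normalize_atom e c t1 t2 : wf_atom R (c, t1, t2) ->
  holds_cmp c (teval e t1) (teval e t2) <->
  holds (@teval V R) e (normalize_atom c t1 t2).
Proof.
rewrite /normalize_atom; have := teval_re_im e (TAdd t1 (TOpp t2)).
case: (re_im _) => r i [/= r_eq i_eq].
have T0E := teval_T0 e; have eq0 (x y : R[i]) : x = y <->
    complex.Re (x - y) = 0 /\ complex.Im (x - y) = 0.
  by case: x y => [a b] [a' b'] /=; split=> [[-> ->]|[/subr0_eq-> /subr0_eq->]];
     rewrite ?subrr.
have eqC0 (x : R) : x%:C = 0 <-> x = 0 by split=> [[]|->].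
case: c => /= [_|_|[/(_ e)+ /(_ e)]|[/(_ e)+ /(_ e)]]; rewrite [ratr _]T0E r_eq ?i_eq.
- by rewrite !eqC0 eq0; split=> [[]|[? []]].
- rewrite !eqC0 eq0; split=> [ne|[re|[im|[]]] []//].
  (* Decidable equality on [R] tells which component of the difference is nonzero. *)
  case: (complex.Re (teval e t1 - teval e t2) =P 0) => [re|]; last by left.
  by right; left=> im; apply: ne.
- rewrite !realCE lecE (lecR _ 0).
  case: (teval e t1) (teval e t2) => [a b] [a' b'] /= /eqP-> /eqP->.
  by rewrite eqxx subr_le0.
- rewrite !realCE ltcE (ltcR _ 0).
  case: (teval e t1) (teval e t2) => [a b] [a' b'] /= /eqP-> /eqP->.
  by rewrite eqxx subr_lt0.
Qed.

Lemma holds_normalize e f : wf_form R f ->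
  holds (@teval V R) e f <-> holds (@teval V R) e (normalize f).
Proof.
move=> fP; move: e; pattern f.
apply: fo_form_Forall_ind fP (Forall_True (quant_vars f))
  => //= [c t1 t2 ? e|g IHg e|fs IHfs e|fs IHfs e|g h IHg IHh e|g h IHg IHh e
         |x g _ IHg e|x g _ IHg e].
- exact: holds_normalize_atom.
- by rewrite IHg.
- by apply: foldr_and_iff; apply: List.Forall_impl IHfs.
- by apply: foldr_or_iff; apply: List.Forall_impl IHfs.
- by rewrite IHg IHh.
- by rewrite IHg IHh.
- by split=> -[a]; exists a; apply/IHg.
- by split=> ga a; apply/IHg.
Qed.

Lemma real_normal_form_normalize f : real_normal_form (normalize f).
Proof.
apply: Forall_all; apply: Forall_atoms_normalize (Forall_True _).
move=> c t1 t2 _; rewrite /normalize_atom.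
have := re_im_poly_re_im (TAdd t1 (TOpp t2)).
by case: (re_im _) => r i /= /andP[rP iP]; case: c => /=;
   repeat constructor; rewrite /= ?rP ?iP normr0 eqxx.
Qed.

(** Order atoms of the result compare a first component of [re_im] with [T0], and both take real
    values. *)
Lemma wf_normalize f : wf_form R (normalize f).
Proof.
apply: Forall_atoms_normalize (Forall_True _) => c t1 t2 _.
rewrite /normalize_atom.
have rR e := (teval_re_im e (TAdd t1 (TOpp t2))).1.
case: (re_im _) rR => r i rR; case: c => /=; repeat constructor;
  by move=> e; rewrite realCE ?teval_T0 ?rR.
Qed.

Lemma atom_vars_normalize f :
  {subset atom_vars (@term_vars V) (normalize f) <= atom_vars (@term_vars V) f}.
Proof.
apply/subset_atom_vars.
(* The trivial inclusion, read atom by atom, is the invariant to transfer: each atom of [f] has its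
   variables among those of [f]. *)
have /subset_atom_vars : {subset atom_vars (@term_vars V) f
  <= atom_vars (@term_vars V) f} by [].
apply: Forall_atoms_normalize => c t1 t2 /= tP; rewrite /normalize_atom.
have := @re_im_vars V (TAdd t1 (TOpp t2)).
case: (re_im _) => r i /= riP.
have rP : {subset term_vars r <= atom_vars (@term_vars V) f}.
  by move=> x xr; apply/tP/riP; rewrite mem_cat xr.
have iP : {subset term_vars i <= atom_vars (@term_vars V) f}.
  by move=> x xi; apply/tP/riP; rewrite mem_cat xi orbT.
by case: c => /=; repeat constructor; rewrite /= cats0.
Qed.

Lemma normalize_normalization (z : seq V) : normalization R z (@normalize V).
Proof.
move=> f [f_prenex f_wf fz]; split.
- split; [exact: prenex_normalize | exact: wf_normalize |].
  move=> x; rewrite /prenex_fv mem_filter quant_vars_normalize => /andP[xq xf].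
  by apply: fz; rewrite mem_filter xq atom_vars_normalize.
- exact: real_normal_form_normalize.
- by move=> e; exact: holds_normalize.
Qed.

End Normalization.

(** * Purification: truth value and free variables *)

Section Purification.
Variables (V : eqType) (R : realType) (re im : V -> V).
Implicit Types (e : V -> R[i]) (er : V -> R) (f : cform V) (vs : seq V).

(** Agreement is confined to [vs], the only place where the auxiliary variables are assumed to be
    distinct. *)
Definition agree vs e er : Prop :=
  {in vs, forall x, er (re x) = complex.Re (e x) /\
                    er (im x) = complex.Im (e x)}.

Lemma teval_purify vs e er (t : term V) :
  agree vs e er -> {subset term_vars t <= vs} -> re_im_poly t ->
  teval e t = (reval er (purify_term re im t))%:C.
Proof.
move=> e_er; elim: t => [x|q||a IHa b IHb|a IHa b IHb|a IHa|a _|a _|a _] //=.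
- by move=> _ _; exact: ratrC.
- move=> abP /andP[a_poly b_poly]; rewrite rmorphD IHa ?IHb //.
    by move=> x xb; apply: abP; rewrite mem_cat xb orbT.
  by move=> x xa; apply: abP; rewrite mem_cat xa.
- move=> abP /andP[a_poly b_poly]; rewrite rmorphM IHa ?IHb //.
    by move=> x xb; apply: abP; rewrite mem_cat xb orbT.
  by move=> x xa; apply: abP; rewrite mem_cat xa.
- by move=> aP a_poly; rewrite rmorphN IHa.
- by case: a => //= x xP _; have [-> _] := e_er x (xP x (mem_head x [::])).
- by case: a => //= x xP _; have [_ ->] := e_er x (xP x (mem_head x [::])).
Qed.

Section Update.
Variable vs : seq V.
Hypotheses (re_inj : {in vs &, injective re}) (im_inj : {in vs &, injective im})
  (re_im_neq : {in vs &, forall x y, re x != im y}).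

(** By injectivity and disjointness on [vs], writing to [re x] and [im x] leaves the auxiliary
    variables of every other [y] in [vs] untouched. *)
Lemma agree_update e er x (a : R[i]) : x \in vs -> agree vs e er ->
  agree vs [eta e with x |-> a]
    [eta [eta er with re x |-> complex.Re a] with im x |-> complex.Im a].
Proof.
move=> x_vs e_er y y_vs /=; have [re_y im_y] := e_er y y_vs.
rewrite (negPf (re_im_neq y_vs x_vs)) (inj_in_eq re_inj) // (inj_in_eq im_inj) //.
rewrite [im y == re x]eq_sym (negPf (re_im_neq x_vs y_vs)).
by case: (y == x).
Qed.

(** The list [vs] contains the bound variables as well as the free ones, so [agree_update] applies
    at each quantifier while [vs] stays fixed. *)
Lemma holds_purify e er f :
  agree vs e er -> {subset all_vars (@term_vars V) f <= vs} ->
  real_normal_form f ->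
  holds (@teval V R) e f <-> holds (@reval V R) er (purify re im f).
Proof.
move=> e_er f_vs f_rnf.
have fP : List.Forall (fun a => {subset term_vars a.1.2 ++ term_vars a.2 <= vs} /\
    re_im_poly a.1.2 && is_T0 a.2) (atoms f).
  apply: List.Forall_and; last exact: all_Forall.
  apply/subset_atom_vars => x xf.
  by apply: f_vs; rewrite mem_cat xf.
have fq : List.Forall (fun x => x \in vs) (quant_vars f).
  apply: all_Forall; apply/allP => x xq.
  by apply: f_vs; rewrite mem_cat xq orbT.
(* The valuations must be general in the induction, since quantifiers change both of them. *)
move: e er e_er; pattern f; apply: fo_form_Forall_ind fP fq
  => //= [c t1 t2 [tP /andP[poly1 T0_2]] e er e_er|g IHg e er e_er
         |fs IHfs e er e_er|fs IHfs e er e_er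
         |g h IHg IHh e er e_er|g h IHg IHh e er e_er
         |x g x_vs IHg e er e_er|x g x_vs IHg e er e_er].
- rewrite (teval_purify e_er _ poly1); last first.
    by move=> x xt; apply: tP; rewrite mem_cat xt.
  rewrite (teval_purify e_er (t := t2)) ?holds_cmp_real //.
    by move=> x xt; apply: tP; rewrite mem_cat xt orbT.
  (* A right-hand side accepted by [is_T0] is a rational constant, hence a polynomial covered by
     [teval_purify]. *)
  by case: (t2) T0_2.
- by rewrite (IHg _ _ e_er).
- by apply: foldr_and_iff; apply: List.Forall_impl IHfs => g; apply.
- by apply: foldr_or_iff; apply: List.Forall_impl IHfs => g; apply.
- by rewrite (IHg _ _ e_er) (IHh _ _ e_er).
- by rewrite (IHg _ _ e_er) (IHh _ _ e_er).
- have IH a := IHg _ _ (agree_update a x_vs e_er).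
  split=> [[a ga]|[u [v guv]]].
    by exists (complex.Re a), (complex.Im a); apply/(IH a).
  (* The components of [u +i* v] reduce to [u] and [v], so the updated real valuation is literally
     the one in the goal. *)
  by exists (u +i* v); apply/(IH (u +i* v)).
- have IH a := IHg _ _ (agree_update a x_vs e_er).
  split=> [gP u v|gP a]; first exact/(IH (u +i* v)).
  exact/(IH a).
Qed.

End Update.

Lemma Forall_atoms_purify (P : cmp * term V * term V -> Prop)
    (Q : cmp * rterm V * rterm V -> Prop) f :
  (forall c t1 t2, P (c, t1, t2) ->
     Q (c, purify_term re im t1, purify_term re im t2)) ->
  List.Forall P (atoms f) -> List.Forall Q (atoms (purify re im f)).
Proof.
move=> PQ fP; pattern f.
apply: fo_form_Forall_ind fP (Forall_True (quant_vars f)) => //= [|fs|fs|g h|g h].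
- by move=> c t1 t2 /PQ; constructor.
- by move=> IHfs; rewrite -map_comp; apply/Forall_flatten_map.
- by move=> IHfs; rewrite -map_comp; apply/Forall_flatten_map.
- by rewrite Forall_cat.
- by rewrite Forall_cat.
Qed.

Definition aux_of vs : seq V := map re vs ++ map im vs.

Lemma purify_term_vars vs (t : term V) :
  {subset term_vars t <= vs} ->
  {subset rterm_vars (purify_term re im t) <= aux_of vs}.
Proof.
elim: t => [x|q||a IHa b IHb|a IHa b IHb|a IHa|a _|a _|a _] //=.
- move=> abP x; rewrite mem_cat => /orP[/IHa|/IHb]; apply=> y yP; apply: abP;
    by rewrite mem_cat yP ?orbT.
- move=> abP x; rewrite mem_cat => /orP[/IHa|/IHb]; apply=> y yP; apply: abP;
    by rewrite mem_cat yP ?orbT.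
- case: a => //= x xP w; rewrite inE => /eqP->.
  by rewrite mem_cat map_f // xP ?mem_head.
- case: a => //= x xP w; rewrite inE => /eqP->.
  by rewrite mem_cat orbC map_f // xP ?mem_head.
Qed.

(** If [w] is an auxiliary variable of [y], then [y] equal to [x] would make [w] one of the two
    excluded variables. *)
Lemma aux_of_quant vs x w :
  w \in aux_of vs -> w != im x -> w != re x ->
  w \in aux_of [seq y <- vs | y != x].
Proof.
rewrite !mem_cat => /orP[] /mapP[y y_vs ->{w}] wim wre;
  apply/orP; [left|right]; rewrite map_f // mem_filter y_vs andbT.
- by apply: contraNneq wre => ->.
- by apply: contraNneq wim => ->.
Qed.

(* Prenexity is needed: only then every occurrence of a quantified variable is
   in the scope of its quantifier. *)
Lemma fv_purify f : prenex f ->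
  {subset fv (@rterm_vars V) (purify re im f)
    <= aux_of (prenex_fv (@term_vars V) f)}.
Proof.
(* In a prenex formula everything below a connective is quantifier-free. This case is therefore
   settled directly, and the induction hypothesis is used only at quantifiers. *)
have fv_qfree g : qfree g -> {subset fv (@rterm_vars V) (purify re im g)
    <= aux_of (prenex_fv (@term_vars V) g)}.
  move=> g_qf; rewrite /prenex_fv qfree_quant_vars // filter_predT.
  apply: fv_subset; set vs := atom_vars _ g.
  have /subset_atom_vars : {subset atom_vars (@term_vars V) g <= vs} by [].
  apply: Forall_atoms_purify => c t1 t2 /= tP x; rewrite mem_cat.
  by case/orP; apply: purify_term_vars => y yt; apply: tP;
     rewrite mem_cat yt ?orbT.
elim/fo_form_nested_ind: f
  => //= [c t1 t2 _|g _|fs _|fs _|g h _ _|g h _ _|x g IHg|x g IHg].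
- exact: (fv_qfree (Atom V c t1 t2)).
- exact: (fv_qfree (Not g)).
- exact: (fv_qfree (And fs)).
- exact: (fv_qfree (Or fs)).
- exact: (fv_qfree (Imp g h)).
- exact: (fv_qfree (Iff g h)).
- move=> g_pr w; rewrite !mem_filter => /and3P[wre wim /(IHg g_pr)].
  (* Dropping the variables bound in [g] and then [x] amounts to a single filter by the variables
     bound in the whole formula. *)
  move=> /aux_of_quant/(_ wim wre); rewrite -filter_predI.
  congr (_ \in aux_of _); apply: eq_filter => y /=.
  by rewrite inE negb_or.
- move=> g_pr w; rewrite !mem_filter => /and3P[wre wim /(IHg g_pr)].
  move=> /aux_of_quant/(_ wim wre); rewrite -filter_predI.
  congr (_ \in aux_of _); apply: eq_filter => y /=.
  by rewrite inE negb_or.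
Qed.

End Purification.

(** * Substituting complex terms for real variables *)

Section Substitution.
Variables (V : eqType) (R : realType).
Implicit Types (e : V -> R[i]) (er : V -> R) (s : V -> term V) (f : rform V).

Lemma teval_subst s e er (t : rterm V) :
  {in rterm_vars t, forall w, teval e (s w) = (er w)%:C} ->
  teval e (subst_term s t) = (reval er t)%:C.
Proof.
elim: t => [w|q|a IHa b IHb|a IHa b IHb|a IHa] /=.
- by apply; exact: mem_head.
(* Constants of the complex language are nonnegative, so a negative rational appears as the opposite
   of its absolute value. *)
- move=> _; have [q0|q0] := leP 0 q; rewrite /= -ratrC.
    by rewrite ger0_norm.
  by rewrite ltr0_norm // rmorphN opprK.
- move=> abP; rewrite rmorphD IHa ?IHb // => w wP; apply: abP;
    by rewrite mem_cat wP ?orbT.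
- move=> abP; rewrite rmorphM IHa ?IHb // => w wP; apply: abP;
    by rewrite mem_cat wP ?orbT.
- by move=> aP; rewrite rmorphN IHa.
Qed.

Lemma qfree_subst s f : qfree f -> qfree (subst s f).
Proof.
elim/fo_form_nested_ind: f => //= [fs|fs|f g IHf IHg|f g IHf IHg].
- exact: Forall_all_map.
- exact: Forall_all_map.
- by move=> /andP[/IHf-> /IHg->].
- by move=> /andP[/IHf-> /IHg->].
Qed.

Lemma Forall_atoms_subst s (P : cmp * rterm V * rterm V -> Prop)
    (Q : cmp * term V * term V -> Prop) f :
  (forall c t1 t2, P (c, t1, t2) -> Q (c, subst_term s t1, subst_term s t2)) ->
  List.Forall P (atoms f) -> List.Forall Q (atoms (subst s f)).
Proof.
move=> PQ fP; pattern f.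
apply: fo_form_Forall_ind fP (Forall_True (quant_vars f)) => //= [|fs|fs|g h|g h].
- by move=> c t1 t2 /PQ; constructor.
- by move=> IHfs; rewrite -map_comp; apply/Forall_flatten_map.
- by move=> IHfs; rewrite -map_comp; apply/Forall_flatten_map.
- by rewrite Forall_cat.
- by rewrite Forall_cat.
Qed.

Lemma holds_subst s e er f : qfree f ->
  {in atom_vars (@rterm_vars V) f, forall w, teval e (s w) = (er w)%:C} ->
  holds (@reval V R) er f <-> holds (@teval V R) e (subst s f).
Proof.
move=> f_qf; set vs := atom_vars _ f => s_er.
have /subset_atom_vars fP : {subset atom_vars (@rterm_vars V) f <= vs} by [].
(* With the invariant [False] on quantified variables, the quantifier cases of the induction are
   vacuous. *)
have fq : List.Forall (fun=> False) (quant_vars f).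
  by rewrite qfree_quant_vars.
pattern f; apply: fo_form_Forall_ind fP fq
  => //= [c t1 t2 tP|g ->|fs IHfs|fs IHfs|g h -> ->|g h -> ->] //.
- rewrite !(@teval_subst s e er) ?holds_cmp_real // => w wt; apply/s_er/tP;
    by rewrite mem_cat wt ?orbT.
- exact: foldr_and_iff.
- exact: foldr_or_iff.
Qed.

Lemma subst_term_vars s z (t : rterm V) :
  {in rterm_vars t, forall w, {subset term_vars (s w) <= z}} ->
  {subset term_vars (subst_term s t) <= z : seq V}.
Proof.
elim: t => [w|q|a IHa b IHb|a IHa b IHb|a IHa] /=.
- by apply; exact: mem_head.
- by case: ifP.
- by move=> abP x; rewrite mem_cat => /orP[/IHa|/IHb]; apply=> w wP; apply: abP;
    rewrite mem_cat wP ?orbT.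
- by move=> abP x; rewrite mem_cat => /orP[/IHa|/IHb]; apply=> w wP; apply: abP;
    rewrite mem_cat wP ?orbT.
- by move=> aP; exact: IHa.
Qed.

(** Order atoms stay well-formed because ring operations on real terms give real terms. *)
Lemma subst_in_Q s z f : qfree f ->
  {in atom_vars (@rterm_vars V) f, forall w, real_term R (s w)} ->
  {in atom_vars (@rterm_vars V) f, forall w, {subset term_vars (s w) <= z}} ->
  in_Q R z (subst s f).
Proof.
move=> f_qf; set vs := atom_vars _ f => s_real s_vars.
have /subset_atom_vars fP : {subset atom_vars (@rterm_vars V) f <= vs} by [].
have s_realT t : {subset rterm_vars t <= vs} -> real_term R (subst_term s t).
  (* Since each [s w] is real, its value is the embedding of its real part. With these real parts as
     valuation, [teval_subst] exhibits the value of the whole term as an embedded real. *)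
  move=> tP e; rewrite (@teval_subst s e (fun w => complex.Re (teval e (s w)))).
    by rewrite realCE.
  move=> w /tP /s_real /(_ e); rewrite realCE.
  by case: (teval e (s w)) => a b /= /eqP->.
split; first exact: qfree_subst.
- apply: Forall_atoms_subst fP => c t1 t2 /= tP.
  have real1 : real_term R (subst_term s t1).
    by apply: s_realT => w wt; apply: tP; rewrite mem_cat wt.
  have real2 : real_term R (subst_term s t2).
    by apply: s_realT => w wt; apply: tP; rewrite mem_cat wt orbT.
  by case: c.
- apply/subset_atom_vars; apply: Forall_atoms_subst fP => c t1 t2 /= tP x.
  rewrite mem_cat => /orP[]; apply: subst_term_vars => w wt; apply/s_vars/tP;
    by rewrite mem_cat wt ?orbT.
Qed.

End Substitution.

(** * Correctness of the three steps *)

Section ThreeStepsCorrect.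
Variables (V : eqType) (R : realType).

Section AuxSubst.
Variables (re im : V -> V) (vs : seq V) (x : V).
Hypotheses (re_inj : {in vs &, injective re}) (im_inj : {in vs &, injective im})
  (re_im_neq : {in vs &, forall x y, re x != im y}) (x_vs : x \in vs).

(** The lookup returns the first match in [vs], and by injectivity the only possible match is
    [x]. *)
Lemma aux_subst_re : aux_subst re im vs (re x) = TRe (TVar x).
Proof.
have : x \in [seq y <- vs | re y == re x] by rewrite mem_filter eqxx.
rewrite /aux_subst; case E: [seq _ <- _ | _] => [//|y s] _.
have : y \in [seq y <- vs | re y == re x] by rewrite E mem_head.
by rewrite mem_filter => /andP[/eqP/re_inj y_x y_vs]; rewrite y_x.
Qed.

(** The search among real auxiliary variables comes first and fails, as [im x] is none of them;
    injectivity of [im] then identifies the match. *)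
Lemma aux_subst_im : aux_subst re im vs (im x) = TIm (TVar x).
Proof.
rewrite /aux_subst.
case E: [seq _ <- _ | _] => [|y s].
  have : x \in [seq y <- vs | im y == im x] by rewrite mem_filter eqxx.
  case E': [seq _ <- _ | _] => [//|y s] _.
  have : y \in [seq y <- vs | im y == im x] by rewrite E' mem_head.
  by rewrite mem_filter => /andP[/eqP/im_inj y_x y_vs]; rewrite y_x.
have : y \in [seq y <- vs | re y == im x] by rewrite E mem_head.
by rewrite mem_filter => /andP[+ y_vs]; rewrite (negPf (re_im_neq y_vs x_vs)).
Qed.

End AuxSubst.

Lemma three_steps_correct (z : seq V) (rqe : rform V -> rform V)
    (phi : cform V) (re im : V -> V) :
  real_qe R rqe -> in_F R z phi -> real_normal_form phi ->
  aux_vars phi re im ->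
  in_Q R z (three_steps rqe re im phi) /\
  C_models R (Iff phi (three_steps rqe re im phi)).
Proof.
move=> rqeP [phi_pr phi_wf phi_z] phi_rnf; rewrite /aux_vars /three_steps.
set vs := all_vars _ phi => -[re_inj im_inj re_im_neq].
set psi := purify re im phi; have [qe_qf qe_vars qeP] := rqeP psi.
set s := aux_subst re im vs.
(* Elimination adds no variables, so those of [rqe psi] are auxiliary variables of free variables of
   [phi], all of which lie in [z]. *)
have s_aux : {in atom_vars (@rterm_vars V) (rqe psi), forall w,
    exists2 x, x \in z & s w = TRe (TVar x) \/ s w = TIm (TVar x)}.
  move=> w /qe_vars/(fv_purify phi_pr); rewrite mem_cat.
  case/orP=> /mapP[x x_fv ->{w}]; exists x; do ?exact: phi_z;
    have x_vs : x \in vs by rewrite mem_cat; move: x_fv;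
      rewrite mem_filter => /andP[_ ->].
  - by left; exact: aux_subst_re.
  - by right; exact: aux_subst_im.
split.
  apply: subst_in_Q => // w /s_aux[x xz].
  - by case=> -> e; rewrite realCE.
  - by case=> -> y /=; rewrite inE => /eqP->.
(* The real valuation is read off from the substitution: it gives the real part of [e x] at [re x]
   and, the imaginary part being real, that part itself at [im x]. Elsewhere its value is
   immaterial. *)
move=> e; pose er w := complex.Re (teval e (s w)).
have e_er : agree re im vs e er.
  by move=> x x_vs; rewrite /er /s aux_subst_re ?aux_subst_im.
rewrite /= (holds_purify re_inj im_inj re_im_neq e_er) // -/psi.
apply: iff_trans (qeP er) _; apply: holds_subst => // w /s_aux[x _].
by rewrite /er; case=> ->.
Qed.

End ThreeStepsCorrect.

Theorem theorem1 (R : realType) (d : Order.disp_t) (V : orderType d)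
    (V_countably_infinite : exists f : nat -> V, bijective f)
    (z : seq V) (z_sorted : sorted (fun x y : V => (x < y)%O) z)
    (rqe : rform V -> rform V) (rqeP : real_qe R rqe) :
  (forall (phi : cform V) (re im : V -> V),
     in_F R z phi -> real_normal_form phi -> aux_vars phi re im ->
     let phi' := three_steps rqe re im phi in
     in_Q R z phi' /\ C_models R (Iff phi phi')) /\
  normalization R z (@normalize V) /\
  (forall (nf : cform V -> cform V) (re im : cform V -> V -> V),
     normalization R z nf ->
     (forall phi : cform V, aux_vars phi (re phi) (im phi)) ->
     complex_qe R z
       (fun phi => three_steps rqe (re (nf phi)) (im (nf phi)) (nf phi))).
Proof.
split; first by move=> phi re im *; exact: three_steps_correct.
split; first exact: normalize_normalization.
move=> nf re im nfP auxP phi /nfP[nf_F nf_rnf phi_nf].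
(* The normal form is again a formula over [z], so the three steps apply to it, and the two
   equivalences compose. *)
have [inQ nf_qe] := three_steps_correct rqeP nf_F nf_rnf (auxP (nf phi)).
by split=> // e; exact: iff_trans (phi_nf e) (nf_qe e).
Qed.
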